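(* Consider two subsystems $$0=\check F(t,z_1,\dot z_1,u_1),\quad y_1=\check G(t,z_1),\qquad\text{and}\qquad 0=\hat F(t,z_2,\dot z_2,u_2),\quad y_2=\hat G(t,z_2).$$ Suppose that both subsystems are strangeness-free, i.e. that they satisfy Hypothesis H (see context) with characteristic values $\check\mu=0,\check a,\check d$ and $\hat\mu=0,\hat a,\hat d$, respectively. If $\tau>0$, then the shifted hybrid numerical-experimental model $$0=\begin{bmatrix}\check F\big(t,z_1(t),\dot z_1(t),\hat G(t-\tau,z_2(t-\tau))\big)\\ \hat F\big(t,z_2(t),\dot z_2(t),\check G(t,z_1(t))\big)\end{bmatrix}$$ satisfies Hypothesis H with characteristic values $\mu=0$, $a=\check a+\hat a$, and $d=\check d+\hat d$.
   Context: Subsystems: $z_i(t)\in\mathbb{R}^{n_i}$, $u_i(t)\in\mathbb{R}^{m_i}$, $y_i(t)\in\mathbb{R}^{p_i}$ with $m_1=p_2$, $m_2=p_1$; $\check F$ and $\hat F$ take values in $\mathbb{R}^{n_1}$ and $\mathbb{R}^{n_2}$; all functions are sufficiently smooth on their (open in state, derivative and input) domains, and the domains are such that the compositions in the coupled model are defined. The state of the hybrid model is $z=[z_1;z_2]\in\mathbb{R}^n$, $n=n_1+n_2$. Hypothesis H for a DAE $F(t,z,\dot z,u)=0$ with $z\in\mathbb{R}^n$, $u\in\mathbb{R}^m$, $F$ with values in $\mathbb{R}^n$: for $\ell\ge 0$ the derivative array is $$\mathcal{D}_\ell(t,z,\eta,u,\dot u,\ldots,u^{(\ell)})=\begin{bmatrix}F(t,z,\dot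 z,u)\\ \frac{\mathrm d}{\mathrm dt}F(t,z,\dot z,u)\\ \vdots\\ (\frac{\mathrm d}{\mathrm dt})^\ell F(t,z,\dot z,u)\end{bmatrix}\in\mathbb{R}^{(\ell+1)n},\qquad \eta=[\dot z;\ldots;z^{(\ell+1)}],$$ where the derivatives are formal total derivatives and $t,z,\eta,u,\ldots,u^{(\ell)}$ are regarded as independent variables. The DAE satisfies Hypothesis H with characteristic values $\mu,a,d$ if $d=n-a$ and there exist (smooth) matrix functions $Z_{\mathrm A}(\cdot)\in\mathbb{R}^{(\mu+1)n\times a}$, $T_{\mathrm A}(\cdot)\in\mathbb{R}^{n\times d}$, $Z_{\mathrm D}(\cdot)\in\mathbb{R}^{n\times d}$ of pointwise maximal rank such that for every sufficiently smooth $u$ the set $\mathcal{M}_\mu=\{(t,z,\eta,u,\ldots,u^{(\mu)})\mid \mathcal{D}_\mu(t,z,\eta,u,\ldots,u^{(\mu)})=0\}$ is nonempty and every point of $\mathcal{M}_\mu$ has a neighborhood $\mathcal{U}$ such that on $\mathcal{M}_\mu\cap\mathcal{U}$: (i) $\operatorname{rank}(\frac{\partial}{\partial\eta}\mathcal{D}_\mu)=(\mu+1)n-a$ and $Z_{\mathrm A}^T\frac{\partial}{\partial\eta}\mathcal{D}_\mu=0$; (ii) $\operatorname{rank}(Z_{\mathrm A}^T\frac{\partial}{\partial z}\mathcal{D}_\mu)=a$ and $Z_{\mathrm A}^T(\frac{\partial}{\partial z}\mathcal{D}_\mu)T_{\mathrm A}=0$; (iii) $\operatorname{rank}(\frac{\partial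 F}{\partial\dot z}T_{\mathrm A})=d$ and $\operatorname{rank}(Z_{\mathrm D}^T\frac{\partial F}{\partial\dot z}T_{\mathrm A})=d$. The smallest possible $\mu$ is the strangeness index; the DAE is strangeness-free if $\mu=0$. A delay equation $0=F(t,z(t),\dot z(t),z(t-\tau))$ is said to satisfy Hypothesis H if its associated DAE $0=F(t,z,\dot z,u)$, obtained by substituting a control function $u(t)\in\mathbb{R}^n$ for $z(t-\tau)$, satisfies it. Standing assumption: the subsystem DAEs are regular, i.e. for every sufficiently smooth input the DAE is solvable (has a continuously differentiable solution on the compact time interval under consideration) and the solution is unique for every consistent initial condition (an initial condition is consistent if the initial value problem has at least one solution). *)

(* Defs.v *)
From mathcomp Require Import all_boot all_order all_algebra.
From mathcomp Require Import all_classical all_reals all_analysis.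

Set Implicit Arguments.
Unset Strict Implicit.
Unset Printing Implicit Defensive.

Import Order.TTheory GRing.Theory Num.Theory.
Import numFieldNormedType.Exports.

Local Open Scope classical_set_scope.
Local Open Scope ring_scope.

(* Vectors of R^n are row vectors, and stacked vectors are row blocks.  Since
   the library Jacobian 'J acts on row vectors from the right, the usual
   Jacobian matrix (one row per component of f) is its transpose. *)
Definition jac (R : realType) p q (f : 'rV[R]_p -> 'rV[R]_q) (x : 'rV[R]_p) :
  'M[R]_(q, p) := ('J f x)^T.

Fixpoint Ck (R : realType) (V W : normedModType R) (k : nat) (U : set V)
    (f : V -> W) : Prop :=
  match k with
  | 0 => forall x, U x -> {for x, continuous f}
  | k'.+1 => (forall x, U x -> differentiable f x) /\
             (forall v, Ck k' U (fun x => 'D_v f x))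
  end.

(* Orders of smoothness: [Some r] for C^r, [None] for C^infinity.  On a set that
   need not be open (a compact interval, the product of such an interval with
   open sets, a zero set), smoothness means that the restriction to that set
   extends to a function of that class on an open neighborhood of it. *)
Definition smooth_on (R : realType) (V W : normedModType R) (r : option nat)
    (A : set V) (f : V -> W) : Prop :=
  exists (U : set V) (g : V -> W),
    [/\ open U, A `<=` U,
        forall k, (if r is Some q then (k <= q)%N else true) -> Ck k U g
      & forall x, A x -> f x = g x].

(* The derivative relative to A: one-sided at the endpoints of an interval. *)
Definition derive_in (R : realType) (V : normedModType R) (A : set R)
    (f : R -> V) (t : R) : V :=
  lim ((fun h : R => h^-1 *: (f (t + h) - f t))
         @ within [set h | A (t + h)] (0 : R)^').

Section DAE.
Variables (R : realType) (n m : nat).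

(* 0 = F(t, z, dz/dt, u), with F relevant on
   I x dom_state x dom_deriv x dom_input for a time interval I. *)
Record dae := DAE {
  dom_state : set 'rV[R]_n;
  dom_deriv : set 'rV[R]_n;
  dom_input : set 'rV[R]_m;
  residual : R -> 'rV[R]_n -> 'rV[R]_n -> 'rV[R]_m -> 'rV[R]_n }.

Definition smooth_dae (s : option nat) (I : set R) (D : dae) : Prop :=
  [/\ open (dom_state D), open (dom_deriv D), open (dom_input D) &
      smooth_on s
        [set p : R^o * 'rV[R]_n * 'rV[R]_n * 'rV[R]_m |
          [/\ I p.1.1.1, dom_state D p.1.1.2, dom_deriv D p.1.2
            & dom_input D p.2]]
        (fun p : R^o * 'rV[R]_n * 'rV[R]_n * 'rV[R]_m =>
           residual D p.1.1.1 p.1.1.2 p.1.2 p.2)].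

Definition admissible_input (s : option nat) (I : set R) (D : dae)
    (u : R -> 'rV[R]_m) : Prop :=
  smooth_on s (I : set R^o) (u : R^o -> _) /\
  forall t, I t -> dom_input D (u t).

Definition is_solution (I : set R) (D : dae) (u : R -> 'rV[R]_m)
    (z : R -> 'rV[R]_n) : Prop :=
  smooth_on (Some 1%N) (I : set R^o) (z : R^o -> _) /\
  forall t, I t ->
    [/\ dom_state D (z t), dom_deriv D (derive_in I z t) &
        residual D t (z t) (derive_in I z t) (u t) = 0].

Definition consistent_init (t0 tf : R) (D : dae) (u : R -> 'rV[R]_m)
    (z0 : 'rV[R]_n) : Prop :=
  exists z, is_solution `[t0, tf]%classic D u z /\ z t0 = z0.

Definition regular_dae (s : option nat) (t0 tf : R) (D : dae) : Prop :=
  forall u, admissible_input s `[t0, tf]%classic D u ->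
    (exists z, is_solution `[t0, tf]%classic D u z) /\
    (forall z0, consistent_init t0 tf D u z0 ->
       forall z z', is_solution `[t0, tf]%classic D u z -> z t0 = z0 ->
                    is_solution `[t0, tf]%classic D u z' -> z' t0 = z0 ->
       forall t, `[t0, tf]%classic t -> z t = z' t).

(* Functions of t and of the jets (z, z', z'', ...), (u, u', u'', ...). *)
Definition jet_fun := R -> (nat -> 'rV[R]_n) -> (nat -> 'rV[R]_m) -> 'rV[R]_n.

(* d/dt = \partial_t + \sum_i z^(i+1) \partial_(z^(i))
                     + \sum_i u^(i+1) \partial_(u^(i)),
   i.e. the derivative in the direction (1, z', z'', ..., u', u'', ...). *)
Definition total_derivative (I : set R) (G : jet_fun) : jet_fun :=
  fun t zj uj =>
    derive_in I (fun s => G s (fun i => zj i + (s - t) *: zj i.+1)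
                              (fun i => uj i + (s - t) *: uj i.+1)) t.

(* Stacking x_0, ..., x_(l-1) in one vector, and reading back the i-th block
   (0 when l <= i). *)
Definition stack k l (x : nat -> 'rV[R]_k) : 'rV[R]_(l * k) :=
  mxvec (\matrix_(i < l) x i).

Definition block k l (v : 'rV[R]_(l * k)) (i : nat) : 'rV[R]_k :=
  if insub i is Some j then row (j : 'I_l) (vec_mx v) else 0.

(* eta = [z'; ...; z^(l+1)], upsilon = [u; u'; ...; u^(l)].  Jets are truncated
   by 0: the total derivatives of order at most l do not involve the rest. *)
Definition derivative_array (I : set R) (D : dae) (l : nat) (t : R)
    (z : 'rV[R]_n) (eta : 'rV[R]_(l.+1 * n)) (upsilon : 'rV[R]_(l.+1 * m)) :
    'rV[R]_(l.+1 * n) :=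
  stack l.+1 (fun i =>
    iter i (total_derivative I)
      (fun t zj uj => residual D t (zj 0%N) (zj 1%N) (uj 0%N))
      t (fun k => if k is k'.+1 then block eta k' else z) (block upsilon)).

Definition jet_space (l : nat) : normedModType R :=
  (R^o * 'rV[R]_n * 'rV[R]_(l.+1 * n) * 'rV[R]_(l.+1 * m))%type.

Definition zero_set (I : set R) (D : dae) (l : nat) : set (jet_space l) :=
  [set x | let: (t, z, eta, upsilon) := x in
    [/\ I t, dom_state D z, dom_deriv D (block eta 0),
        dom_input D (block upsilon 0) &
        derivative_array I D t z eta upsilon = 0]].

Definition rank_conditions (I : set R) (D : dae) (mu a d : nat)
    (ZA : jet_space mu -> 'M[R]_(mu.+1 * n, a))
    (TA ZD : jet_space mu -> 'M[R]_(n, d)) (x : jet_space mu) : Prop :=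
  let: (t, z, eta, upsilon) := x in
  let D_eta := jac (fun e => derivative_array I D t z e upsilon) eta in
  let D_z := jac (fun y => derivative_array I D t y eta upsilon) z in
  let F_dz := jac (fun w => residual D t z w (block upsilon 0)) (block eta 0) in
  [/\ \rank D_eta = (mu.+1 * n - a)%N /\ (ZA x)^T *m D_eta = 0,
      \rank ((ZA x)^T *m D_z) = a /\ (ZA x)^T *m D_z *m TA x = 0 &
      \rank (F_dz *m TA x) = d /\ \rank ((ZD x)^T *m F_dz *m TA x) = d].

(* The order r quantifies "sufficiently smooth": the matrix functions, built
   from first-order derivatives of the derivative array, are C^r, and inputs
   are C^(mu+1+r).  The matrix functions are smooth functions on (a
   neighborhood of) the zero set of the derivative array. *)
Definition hypothesis_H (r : option nat) (I : set R) (D : dae)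
    (mu a d : nat) : Prop :=
  [/\ (a <= n)%N, d = (n - a)%N &
  exists (ZA : jet_space mu -> 'M[R]_(mu.+1 * n, a))
         (TA ZD : jet_space mu -> 'M[R]_(n, d)),
  let M := zero_set I D (l := mu) in
  [/\ [/\ smooth_on r M ZA, smooth_on r M TA & smooth_on r M ZD],
      forall x, M x -> [/\ \rank (ZA x) = a, \rank (TA x) = d
                         & \rank (ZD x) = d],
      forall u, admissible_input (omap (addn mu.+1) r) I D u ->
        exists t z eta,
          M (t, z, eta, stack mu.+1 (fun i => iter i (derive_in I) u t)) &
      forall x, M x -> exists2 U, nbhs x U &
        forall y, (M `&` U) y -> rank_conditions I D ZA TA ZD y]].

End DAE.

(* 0 = F(t, z(t), dz/dt(t), z(t - tau)). *)
Record delay_equation (R : realType) (n : nat) := DelayEquation {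
  delay : R;
  delay_dom_state : set 'rV[R]_n;
  delay_dom_deriv : set 'rV[R]_n;
  delay_residual : R -> 'rV[R]_n -> 'rV[R]_n -> 'rV[R]_n -> 'rV[R]_n }.

Definition associated_dae (R : realType) n (E : delay_equation R n) :
    dae R n n :=
  DAE (delay_dom_state E) (delay_dom_deriv E) (delay_dom_state E)
      (delay_residual E).

Definition delay_hypothesis_H (R : realType) n (r : option nat) (I : set R)
    (E : delay_equation R n) (mu a d : nat) : Prop :=
  hypothesis_H r I (associated_dae E) mu a d.

Definition shifted_hybrid (R : realType) n1 n2 m1 m2 (tau : R)
    (D1 : dae R n1 m1) (G1 : R -> 'rV[R]_n1 -> 'rV[R]_m2)
    (D2 : dae R n2 m2) (G2 : R -> 'rV[R]_n2 -> 'rV[R]_m1) :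
    delay_equation R (n1 + n2) :=
  DelayEquation tau
    [set z | dom_state D1 (lsubmx z) /\ dom_state D2 (rsubmx z)]
    [set w | dom_deriv D1 (lsubmx w) /\ dom_deriv D2 (rsubmx w)]
    (fun t z w zdelayed =>
       row_mx
         (residual D1 t (lsubmx z) (lsubmx w) (G2 (t - tau) (rsubmx zdelayed)))
         (residual D2 t (rsubmx z) (rsubmx w) (G1 t (lsubmx z)))).

(* Main.v *)
From HB Require Import structures.
Require Import Defs.
From mathcomp Require Import all_boot all_order all_algebra.
From mathcomp Require Import all_classical all_reals all_analysis.
Import Order.TTheory GRing.Theory Num.Theory.
Import numFieldNormedType.Exports.
Local Open Scope classical_set_scope.
Local Open Scope ring_scope.

(** In the associated DAE of the shifted model the delayed state is a control
    that is independent of the state.  Only the second subsystem then sees the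
    current state of the other one, so that the Jacobian of the coupled residual
    with respect to the state is block lower triangular, while the Jacobian with
    respect to the derivative of the state is block diagonal.  The ranks in
    Hypothesis H are then the sums of the ranks of the diagonal blocks, which are
    those of the subsystems ([pencil_conditions_block]).

    The matrix functions are taken from the subsystems: [ZA] and [ZD] are block
    diagonal, and [TA] is block triangular ([coupled_kernel]).  Its lower left
    block corrects the second component of the kernel vectors of the first
    subsystem for the coupling; it uses the Moore-Penrose right inverse of the
    algebraic part of the second subsystem.  This inverse is a smooth function of
    a matrix of full row rank, so what remains for smoothness is a calculus of
    functions that extend smoothly to a neighborhood of a given set: composition,
    products, inverses and partial derivatives ([smooth_on_comp],
    [smooth_on_invmx], [smooth_on_jac_state]).

    The zero set has to be nonempty for each control.  Solving the subsystems
    one after the other loses smoothness: a solution of the first one, whose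
    output is the input of the second one, is only known to be of class C^1.
    But the zero set is defined pointwise: at a zero of the first subsystem,
    freeze its state [z1] and solve the second subsystem for the smooth input
    [fun s => G1 s z1]; at the time of the zero this is the required input
    ([hybrid_zeros_nonempty]).

    For [mu = 0] the derivative array is the residual, up to the reshaping of
    stacked vectors; [strangeness_free] is Hypothesis H without the reshaping. *)

Set Implicit Arguments.
Unset Strict Implicit.
Unset Printing Implicit Defensive.

(** * Functions of class C^k between finite-dimensional spaces *)

(** Differentiability only depends on the germ of the function. *)
Lemma near_eq_differentiable (R : realType) (V W : normedModType R)
    (f g : V -> W) (x : V) :
  (\forall y \near x, f y = g y) -> differentiable f x -> differentiable g x.
Proof.
move=> fg df.
have E : g \o shift x = cst (g x) + 'd f x +o_ (0 : V) id.
  have := diff_locally df => /eqaddoP fo.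
  apply/eqaddoP => e e0.
  have fg0 : \forall h \near (0 : V), f (h + x) = g (h + x).
    by move: fg; rewrite (near_shift 0 x) subr0.
  have fgx : f x = g x := nbhs_singleton fg.
  near=> h.
  have -> : (g \o shift x - (cst (g x) + 'd f x)) h
          = (f \o shift x - (cst (f x) + 'd f x)) h.
    rewrite !fctE /= -fgx; congr (_ - _); apply/esym.
    by near: h.
  by near: h; exact: fo.
apply/diff_locallyP; have dg := diff_unique (diff_continuous df) E.
by rewrite dg; split=> //; exact: diff_continuous.
Unshelve. all: by end_near. Qed.

(** Coordinates turn the chain rule into a finite sum of products: they let the
    class [Ck], whose derivatives are directional, be propagated through
    compositions. *)
Class finite_dim (R : realType) (V : normedModType R) : Prop :=
  finite_dimE : exists (T : finType) (e : T -> V) (c : T -> {linear V -> R^o}),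
    (forall i, continuous (c i)) /\ forall v, v = \sum_i c i v *: e i.

#[global] Instance finite_dim_reg (R : realType) : finite_dim R^o.
Proof.
exists unit, (fun=> 1 : R^o), (fun=> (idfun : {linear R^o -> R^o})).
split=> [_ ?|v]; first by [].
by rewrite big_const card_unit /= addr0 [RHS]mulr1.
Qed.

#[global] Instance finite_dim_mx (R : realType) m n : finite_dim 'M[R]_(m, n).
Proof.
have lc (ij : 'I_m * 'I_n) : linear (fun A : 'M[R]_(m, n) => A ij.1 ij.2 : R^o).
  by move=> a A B; rewrite !mxE.
pose c ij : {linear 'M[R]_(m, n) -> R^o} :=
  HB.pack (fun A : 'M[R]_(m, n) => A ij.1 ij.2 : R^o)
    (GRing.isLinear.Build _ _ _ _ _ (lc ij)).
exists ('I_m * 'I_n)%type, (fun ij => delta_mx ij.1 ij.2), c; split.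
  by move=> ij; exact: coord_continuous.
by move=> A; rewrite {1}[A]matrix_sum_delta pair_big.
Qed.

#[global] Instance finite_dim_prod (R : realType) (V W : normedModType R) :
  finite_dim V -> finite_dim W -> finite_dim (V * W)%type.
Proof.
move=> [T1 [e1 [c1 [c1c v1]]]] [T2 [e2 [c2 [c2c v2]]]].
pose c (i : T1 + T2) : {linear (V * W)%type -> R^o} :=
  match i with
  | inl j => (c1 j \o fst)
  | inr j => (c2 j \o snd)
  end.
exists (T1 + T2)%type,
  (fun i => match i with inl j => (e1 j, 0) | inr j => (0, e2 j) end), c.
split.
  case=> j v /=.
    by apply: (@continuous_comp _ _ _ fst (c1 j)); [exact: cvg_fst|exact: c1c].
  by apply: (@continuous_comp _ _ _ snd (c2 j)); [exact: cvg_snd|exact: c2c].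
move=> [v w]; rewrite big_sumType /=.
have -> : \sum_i c1 i v *: (e1 i, 0 : W) = (v, 0).
  rewrite {2}[v]v1.
  by elim/big_rec2: _ => [//|i y y2 _ ->]; congr pair; rewrite /= scaler0 add0r.
have -> : \sum_i c2 i w *: (0 : V, e2 i) = (0, w).
  rewrite {2}[w]v2.
  by elim/big_rec2: _ => [//|i y y2 _ ->]; congr pair; rewrite /= scaler0 add0r.
by congr pair; rewrite ?addr0 ?add0r.
Qed.

Lemma linear_continuous_fd (R : realType) (V W : normedModType R)
    (L : {linear V -> W}) : finite_dim V -> continuous L.
Proof.
move=> [T [e [c [cc vE]]]].
have -> : (L : V -> W) = fun v => \sum_i c i v *: L (e i).
  by apply/funext => v; rewrite {1}[v]vE linear_sum; apply: eq_bigr => i _;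
    rewrite linearZ.
move=> v; apply: cvg_big => [|i _]; first exact: add_continuous.
by apply: cvgZr_tmp; exact: cc.
Qed.

Section Ck_theory.
Variable R : realType.
Implicit Types V W X : normedModType R.

Lemma Ck_eq V W k (U : set V) (f g : V -> W) : open U ->
  (forall x, U x -> f x = g x) -> Ck k U f -> Ck k U g.
Proof.
move=> oU; have near_eq (h1 h2 : V -> W) x : U x ->
    (forall x, U x -> h1 x = h2 x) -> \forall y \near x, h1 y = h2 y.
  by move=> Ux h12; near=> y; apply: h12; near: y; exact: open_nbhs_nbhs.
elim: k f g => [|k IH] f g fg.
  move=> /= fc x Ux.
  suff : g @ x --> f x by rewrite fg.
  by apply: cvg_trans (fc x Ux); apply: near_eq_cvg; exact: near_eq.
move=> [df Df]; split=> [x Ux|v].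
  by apply: (near_eq_differentiable _ (df x Ux)); exact: near_eq.
apply: IH (Df v) => x Ux; apply: near_eq_derive; exact: near_eq.
Unshelve. all: by end_near. Qed.

Lemma Ck_pred V W k (U : set V) (f : V -> W) : Ck k.+1 U f -> Ck k U f.
Proof.
elim: k f => [|k IH] f [df Df]; last by split=> // v; exact: IH.
by move=> x /df; exact: differentiable_continuous.
Qed.

Lemma Ck_subset V W k (U U' : set V) (f : V -> W) :
  U' `<=` U -> Ck k U f -> Ck k U' f.
Proof.
move=> sU; elim: k f => [|k IH] f; first by move=> fc x /sU /fc.
by move=> [df Df]; split=> [x /sU /df //|v]; exact: IH (Df v).
Qed.

Lemma Ck_cst V W k (U : set V) (w : W) : Ck k U (fun _ : V => w).
Proof.
elim: k w => [|k IH] w; first by move=> x _; exact: cst_continuous.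
split=> [x _|v]; first exact: differentiable_cst.
rewrite (_ : 'D_v _ = fun=> 0); first exact: IH.
by apply/funext => x; exact: derive_cst.
Qed.

Lemma derive_linear_comp V W W' (L : {linear W -> W'}) (f : V -> W) x v :
  continuous L -> differentiable f x -> 'D_v (L \o f) x = L ('D_v f x).
Proof.
move=> cL df; have dL := linear_differentiable (f x) cL.
rewrite !deriveE //; last exact: differentiable_comp.
by rewrite diff_comp //= diff_lin.
Qed.

Lemma Ck_linear_comp V W W' k (U : set V) (L : {linear W -> W'}) (f : V -> W) :
  open U -> continuous L -> Ck k U f -> Ck k U (L \o f).
Proof.
move=> oU cL; elim: k f => [|k IH] f.
  by move=> fc x Ux; apply: continuous_comp; [exact: fc|exact: cL].
move=> [df Df]; split=> [x Ux|v].
  apply: differentiable_comp; [exact: df|exact: linear_differentiable].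
apply: Ck_eq (IH _ (Df v)) => // x Ux.
by rewrite derive_linear_comp//; exact: df.
Qed.

Lemma Ck_linear V W k (U : set V) (L : {linear V -> W}) :
  continuous L -> Ck k U L.
Proof.
move=> cL; case: k => [|k]; first by move=> x _; exact: cL.
split=> [x _|v]; first exact: linear_differentiable.
rewrite (_ : 'D_v _ = fun=> L v); first exact: Ck_cst.
apply/funext => x; rewrite deriveE ?diff_lin//; exact: linear_differentiable.
Qed.

Lemma Ck_add V W k (U : set V) (f g : V -> W) : open U ->
  Ck k U f -> Ck k U g -> Ck k U (fun x => f x + g x).
Proof.
move=> oU; elim: k f g => [|k IH] f g.
  by move=> fc gc x Ux; apply: continuousD; [exact: fc|exact: gc].
move=> [df Df] [dg Dg]; split=> [x Ux|v].
  by apply: differentiableD; [exact: df|exact: dg].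
apply: Ck_eq (IH _ _ (Df v) (Dg v)) => // x Ux.
by rewrite -deriveD//; apply: diff_derivable; [exact: df|exact: dg].
Qed.

Lemma Ck_sum V W k (U : set V) (T : Type) (r : seq T) (P : pred T)
    (f : T -> V -> W) : open U ->
  (forall i, P i -> Ck k U (f i)) -> Ck k U (fun x => \sum_(i <- r | P i) f i x).
Proof.
move=> oU Cf; elim: r => [|i r IH].
  by apply: Ck_eq (Ck_cst _ _ 0) => // x _; rewrite big_nil.
case: (boolP (P i)) => Pi; last first.
  by apply: Ck_eq IH => // x _; rewrite big_cons (negPf Pi).
by apply: Ck_eq (Ck_add oU (Cf i Pi) IH) => // x _; rewrite big_cons Pi.
Qed.

Lemma Ck_mul V k (U : set V) (f g : V -> R^o) : open U ->
  Ck k U f -> Ck k U g -> Ck k U (fun x => f x * g x : R^o).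
Proof.
move=> oU; elim: k f g => [|k IH] f g.
  by move=> fc gc x Ux; apply: continuousM; [exact: fc|exact: gc].
move=> Cf Cg; have [df Df] := Cf; have [dg Dg] := Cg; split=> [x Ux|v].
  by apply: differentiableM; [exact: df|exact: dg].
apply: (@Ck_eq _ _ _ _ (fun x => f x * 'D_v g x + g x * 'D_v f x)) => //.
  move=> x Ux; apply/esym/(@deriveM _ _ f g); apply: diff_derivable.
    exact: df.
  exact: dg.
exact: Ck_add (IH _ _ (Ck_pred Cf) (Dg v)) (IH _ _ (Ck_pred Cg) (Df v)).
Qed.

(** The derivative of [1 / f] is a polynomial in [1 / f] and in the derivative
    of [f], so an induction on the order only needs [1 / f] at the previous order. *)
Lemma Ck_inv V k (U : set V) (f : V -> R^o) : open U ->
  (forall x, U x -> f x != 0) -> Ck k U f -> Ck k U (fun x => (f x)^-1 : R^o).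
Proof.
move=> oU f0; elim: k => [|k IH].
  by move=> fc x Ux; apply: continuousV; [exact: f0|exact: fc].
move=> Cf; have [df Df] := Cf; split=> [x Ux|v].
  by apply: differentiableV; [exact: df|exact: f0].
apply: (@Ck_eq _ _ _ _ (fun x => -1 * ((f x)^-1 * (f x)^-1 * 'D_v f x))) => //.
  move=> x Ux; rewrite deriveV ?f0//; last by apply: diff_derivable; exact: df.
  by rewrite mulN1r scaleNr expr2 invfM.
have If := IH (Ck_pred Cf).
exact: Ck_mul oU (Ck_cst _ _ _) (Ck_mul oU (Ck_mul oU If If) (Df v)).
Qed.

(** Along coordinates of the target, the product of a scalar function and a
    vector function is a sum of products of scalar functions. *)
Lemma Ck_scale V W k (U : set V) (a : V -> R^o) (f : V -> W) :
  finite_dim W -> open U ->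
  Ck k U a -> Ck k U f -> Ck k U (fun x => a x *: f x).
Proof.
move=> [T [e [c [cc vE]]]] oU Ca Cf.
apply: (@Ck_eq _ _ _ _ (fun x => \sum_i (a x * c i (f x)) *: e i)) => //.
  move=> x _; rewrite {2}[f x]vE scaler_sumr; apply: eq_bigr => i _.
  by rewrite scalerA.
apply: Ck_sum => // i _.
have le : linear (fun b : R^o => b *: e i).
  by move=> b u v; rewrite scalerDl scalerA.
pose L : {linear R^o -> W} :=
  HB.pack (fun b : R^o => b *: e i) (GRing.isLinear.Build _ _ _ _ _ le).
apply: (@Ck_linear_comp _ _ _ _ _ L (fun x => a x * c i (f x) : R^o)) => //.
  exact: scalel_continuous.
apply: Ck_mul => //; exact: (Ck_linear_comp oU (cc i) Cf).
Qed.

(** By the chain rule, a directional derivative of [f \o g] is a combination of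
    the partial derivatives of [f] taken at [g x], which are compositions of the
    same kind with one derivative less; the coefficients are the coordinates of
    the derivative of [g]. *)
Lemma Ck_comp V W X k (U : set V) (U' : set W) (g : V -> W) (f : W -> X) :
  finite_dim W -> finite_dim X -> open U -> (forall x, U x -> U' (g x)) ->
  Ck k U g -> Ck k U' f -> Ck k U (f \o g).
Proof.
move=> fW fX oU gU; elim: k f => [|k IH] f.
  move=> gc fc x Ux; apply: continuous_comp; [exact: gc|exact/fc/gU].
move=> Cg [df Df]; have [dg Dg] := Cg.
split=> [x Ux|v].
  by apply: differentiable_comp; [exact: dg|exact/df/gU].
have [T [e [c [cc vE]]]] := fW.
apply: (@Ck_eq _ _ _ _ (fun x => \sum_i c i ('D_v g x) *: 'D_(e i) f (g x))).
- by [].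
- move=> x Ux; have dgx := dg _ Ux; have dfx := df _ (gU _ Ux).
  rewrite (deriveE _ (differentiable_comp dgx dfx)) diff_comp //=.
  rewrite -(deriveE _ dgx) {2}['D_v g x]vE linear_sum; apply: eq_bigr => i _.
  by rewrite (deriveE _ dfx) linearZ.
apply: Ck_sum => // i _; apply: Ck_scale => //.
  exact: (Ck_linear_comp oU (cc i) (Dg v)).
exact: (IH _ (Ck_pred Cg) (Df (e i))).
Qed.

End Ck_theory.

(** * Smoothness relative to a set that need not be open *)

Lemma open_preimage_in (S T : topologicalType) (U : set S) (U' : set T)
    (g : S -> T) : open U -> open U' ->
  (forall x, U x -> {for x, continuous g}) -> open (U `&` g @^-1` U').
Proof.
move=> oU oU' gc; rewrite openE => x [Ux gx]; apply: filterI.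
  exact: open_nbhs_nbhs.
by apply: (gc x Ux); exact: open_nbhs_nbhs.
Qed.

Section smooth_on_theory.
Variable R : realType.
Implicit Types (V W X : normedModType R) (r : option nat).

Lemma smooth_on_subset V W r (A B : set V) (f : V -> W) :
  A `<=` B -> smooth_on r B f -> smooth_on r A f.
Proof.
move=> AB [U [g [oU BU Cg fg]]]; exists U, g; split=> //.
  exact: subset_trans BU.
by move=> x /AB /fg.
Qed.

Lemma smooth_on_eq V W r (A : set V) (f g : V -> W) :
  (forall x, A x -> f x = g x) -> smooth_on r A f -> smooth_on r A g.
Proof.
move=> fg [U [h [oU AU Ch fh]]]; exists U, h; split=> // x Ax.
by rewrite -fg// fh.
Qed.

Lemma smooth_on_pred V W r (A : set V) (f : V -> W) :
  smooth_on (omap S r) A f -> smooth_on r A f.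
Proof.
move=> [U [g [oU AU Cg fg]]]; exists U, g; split=> // k kr; apply: Cg.
by case: r kr => //= q; exact: leqW.
Qed.

Lemma smooth_on_linear V W r (A : set V) (f : V -> W) :
  finite_dim V -> linear f -> smooth_on r A f.
Proof.
move=> fV lf; exists setT, f; split=> // [|k _]; first exact: openT.
pose L : {linear V -> W} := HB.pack f (GRing.isLinear.Build _ _ _ _ _ lf).
exact: (@Ck_linear _ _ _ _ _ L (linear_continuous_fd fV)).
Qed.

Lemma smooth_on_cst V W r (A : set V) (w : W) : smooth_on r A (fun=> w).
Proof.
by exists setT, (fun=> w); split=> // [|k _]; [exact: openT|exact: Ck_cst].
Qed.

(** The composition of the two extensions lives on the preimage of the domain of
    the second one, which is still an open neighborhood of [A]. *)
Lemma smooth_on_comp V W X r (A : set V) (B : set W) (g : V -> W) (f : W -> X) :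
  finite_dim W -> finite_dim X -> (forall x, A x -> B (g x)) ->
  smooth_on r A g -> smooth_on r B f -> smooth_on r A (fun x => f (g x)).
Proof.
move=> fW fX AB [U [g' [oU AU Cg gg']]] [U' [f' [oU' BU' Cf ff']]].
have C0 : Ck 0 U g' by apply: Cg; case: (r).
have oU'' := open_preimage_in oU oU' C0.
exists (U `&` g' @^-1` U'), (f' \o g'); split=> // [x Ax|k kr|x Ax].
- by split; [exact: AU|rewrite /= -gg'//; exact/BU'/AB].
- apply: Ck_comp (Cf k kr) => //; first by move=> x [].
  by apply: Ck_subset (Cg k kr) => x [].
- by rewrite /= -gg'// ff'//; exact: AB.
Qed.

Lemma smooth_on_linear_comp V W X r (A : set V) (g : V -> W) (f : W -> X) :
  finite_dim W -> finite_dim X -> linear f -> smooth_on r A g ->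
  smooth_on r A (fun x => f (g x)).
Proof.
move=> fW fX lf sg; apply: (@smooth_on_comp _ _ _ _ _ setT) => //.
exact: smooth_on_linear.
Qed.

Lemma smooth_on_add V W r (A : set V) (f g : V -> W) :
  smooth_on r A f -> smooth_on r A g -> smooth_on r A (fun x => f x + g x).
Proof.
move=> [U [f' [oU AU Cf ff']]] [U' [g' [oU' AU' Cg gg']]].
have oUU' : open (U `&` U') by exact: openI.
exists (U `&` U'), (fun x => f' x + g' x); split=> // [x Ax|k kr|x Ax].
- by split; [exact: AU|exact: AU'].
- apply: Ck_add => //.
    by apply: Ck_subset (Cf k kr) => x [].
  by apply: Ck_subset (Cg k kr) => x [].
- by rewrite ff'// gg'.
Qed.

Lemma smooth_on_sum V W r (A : set V) (T : Type) (s : seq T) (P : pred T)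
    (f : T -> V -> W) :
  (forall i, P i -> smooth_on r A (f i)) ->
  smooth_on r A (fun x => \sum_(i <- s | P i) f i x).
Proof.
move=> sf; elim: s => [|i s IH].
  by apply: smooth_on_eq (smooth_on_cst _ _ 0) => x _; rewrite big_nil.
case: (boolP (P i)) => Pi; last first.
  by apply: smooth_on_eq IH => x _; rewrite big_cons (negPf Pi).
by apply: smooth_on_eq (smooth_on_add (sf i Pi) IH) => x _; rewrite big_cons Pi.
Qed.

Lemma smooth_on_scale V W r (A : set V) (a : V -> R^o) (f : V -> W) :
  finite_dim W ->
  smooth_on r A a -> smooth_on r A f -> smooth_on r A (fun x => a x *: f x).
Proof.
move=> fW [U [f' [oU AU Cf ff']]] [U' [g' [oU' AU' Cg gg']]].
have oUU' : open (U `&` U') by exact: openI.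
exists (U `&` U'), (fun x => f' x *: g' x); split=> // [x Ax|k kr|x Ax].
- by split; [exact: AU|exact: AU'].
- apply: Ck_scale => //.
    by apply: Ck_subset (Cf k kr) => x [].
  by apply: Ck_subset (Cg k kr) => x [].
- by rewrite ff'// gg'.
Qed.

Lemma smooth_on_mul V r (A : set V) (f g : V -> R^o) :
  smooth_on r A f -> smooth_on r A g -> smooth_on r A (fun x => f x * g x : R^o).
Proof. exact: smooth_on_scale. Qed.

Lemma smooth_on_prod V r (A : set V) (T : Type) (s : seq T) (P : pred T)
    (f : T -> V -> R^o) :
  (forall i, P i -> smooth_on r A (f i)) ->
  smooth_on r A (fun x => \prod_(i <- s | P i) f i x : R^o).
Proof.
move=> sf; elim: s => [|i s IH].
  by apply: smooth_on_eq (smooth_on_cst _ _ (1 : R^o)) => x _; rewrite big_nil.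
case: (boolP (P i)) => Pi; last first.
  by apply: smooth_on_eq IH => x _; rewrite big_cons (negPf Pi).
by apply: smooth_on_eq (smooth_on_mul (sf i Pi) IH) => x _; rewrite big_cons Pi.
Qed.

(** The extension of [f] may vanish outside [A]: its domain is cut down to the
    open set where it is nonzero. *)
Lemma smooth_on_inv V r (A : set V) (f : V -> R^o) :
  (forall x, A x -> f x != 0) ->
  smooth_on r A f -> smooth_on r A (fun x => (f x)^-1 : R^o).
Proof.
move=> f0 [U [g [oU AU Cg fg]]].
have C0 : Ck 0 U g by apply: Cg; case: (r).
have oU' := open_preimage_in oU (@open_neq _ (0 : R)) C0.
exists (U `&` g @^-1` [set y | y != 0]), (fun x => (g x)^-1).
split=> // [x Ax|k kr|x Ax].
- by split; [exact: AU|rewrite /= -fg//; exact: f0].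
- apply: Ck_inv => //; first by move=> x [].
  by apply: Ck_subset (Cg k kr) => x [].
- by rewrite fg.
Qed.

Lemma smooth_on_pair V W X r (A : set V) (f : V -> W) (g : V -> X) :
  finite_dim W -> finite_dim X ->
  smooth_on r A f -> smooth_on r A g -> smooth_on r A (fun x => (f x, g x)).
Proof.
move=> fW fX sf sg.
apply: (@smooth_on_eq _ _ _ _ (fun x => (f x, 0) + (0, g x))).
  by move=> x _; congr pair; rewrite ?addr0 ?add0r.
apply: smooth_on_add.
  apply: (@smooth_on_linear_comp _ _ _ _ _ _ (fun w => (w, 0 : X))) => // a u v.
  by congr pair; rewrite /= scaler0 addr0.
apply: (@smooth_on_linear_comp _ _ _ _ _ _ (fun w => (0 : W, w))) => // a u v.
by congr pair; rewrite /= scaler0 addr0.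
Qed.

Lemma smooth_on_fst3 (V1 V2 V3 V4 : normedModType R) r
    (A : set (V1 * V2 * V3 * V4)%type) :
  finite_dim V1 -> finite_dim V2 -> finite_dim V3 -> finite_dim V4 ->
  smooth_on r A (fun x => x.1.1.1).
Proof. by move=> *; apply: smooth_on_linear. Qed.

Lemma smooth_on_mxP V r (A : set V) m n (f : V -> 'M[R]_(m, n)) :
  smooth_on r A f <-> forall i j, smooth_on r A (fun x => f x i j : R^o).
Proof.
split=> [sf i j|sf].
  apply: (smooth_on_linear_comp (f := fun M : 'M[R]_(m, n) => M i j : R^o)) sf.
  by move=> a M N; rewrite !mxE.
apply: (@smooth_on_eq _ _ _ _ (fun x => \sum_i \sum_j f x i j *: delta_mx i j)).
  by move=> x _; rewrite -matrix_sum_delta.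
do 2! apply: smooth_on_sum => ? _.
by apply: smooth_on_scale => //; exact: smooth_on_cst.
Qed.

Lemma smooth_on_mulmx V r (A : set V) m n p
    (f : V -> 'M[R]_(m, n)) (g : V -> 'M[R]_(n, p)) :
  smooth_on r A f -> smooth_on r A g -> smooth_on r A (fun x => f x *m g x).
Proof.
move=> /smooth_on_mxP sf /smooth_on_mxP sg; apply/smooth_on_mxP => i j.
apply: (@smooth_on_eq _ _ _ _ (fun x => \sum_k f x i k * g x k j : R^o)).
  by move=> x _; rewrite mxE.
by apply: smooth_on_sum => k _; exact: smooth_on_mul.
Qed.

Lemma smooth_on_tr V r (A : set V) m n (f : V -> 'M[R]_(m, n)) :
  smooth_on r A f -> smooth_on r A (fun x => (f x)^T).
Proof. by apply: smooth_on_linear_comp => a M N; rewrite linearP. Qed.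

Lemma smooth_on_block V r (A : set V) m1 m2 n1 n2
    (f11 : V -> 'M[R]_(m1, n1)) (f12 : V -> 'M[R]_(m1, n2))
    (f21 : V -> 'M[R]_(m2, n1)) (f22 : V -> 'M[R]_(m2, n2)) :
  smooth_on r A f11 -> smooth_on r A f12 ->
  smooth_on r A f21 -> smooth_on r A f22 ->
  smooth_on r A (fun x => block_mx (f11 x) (f12 x) (f21 x) (f22 x)).
Proof.
move=> /smooth_on_mxP s11 /smooth_on_mxP s12 /smooth_on_mxP s21 /smooth_on_mxP s22.
apply/smooth_on_mxP => i j; case: (split_ordP i) => i' ->;
  case: (split_ordP j) => j' ->.
- by apply: smooth_on_eq (s11 i' j') => x _; rewrite block_mxEul.
- by apply: smooth_on_eq (s12 i' j') => x _; rewrite block_mxEur.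
- by apply: smooth_on_eq (s21 i' j') => x _; rewrite block_mxEdl.
- by apply: smooth_on_eq (s22 i' j') => x _; rewrite block_mxEdr.
Qed.

Lemma smooth_on_row_mx V r (A : set V) m n1 n2
    (f : V -> 'M[R]_(m, n1)) (g : V -> 'M[R]_(m, n2)) :
  smooth_on r A f -> smooth_on r A g ->
  smooth_on r A (fun x => row_mx (f x) (g x)).
Proof.
move=> /smooth_on_mxP sf /smooth_on_mxP sg; apply/smooth_on_mxP => i j.
case: (split_ordP j) => k ->.
  by apply: smooth_on_eq (sf i k) => x _; rewrite row_mxEl.
by apply: smooth_on_eq (sg i k) => x _; rewrite row_mxEr.
Qed.

Lemma smooth_on_det V r (A : set V) n (f : V -> 'M[R]_n) :
  smooth_on r A f -> smooth_on r A (fun x => \det (f x) : R^o).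
Proof.
move=> /smooth_on_mxP sf; apply: smooth_on_sum => s _.
apply: smooth_on_mul; first exact: smooth_on_cst.
by apply: smooth_on_prod => i _; exact: sf.
Qed.

(** By Cramer's rule, the entries of the inverse are quotients of polynomials in
    the entries of the matrix. *)
Lemma smooth_on_invmx V r (A : set V) n (f : V -> 'M[R]_n) :
  (forall x, A x -> f x \in unitmx) ->
  smooth_on r A f -> smooth_on r A (fun x => invmx (f x)).
Proof.
move=> fu sf.
apply: (@smooth_on_eq _ _ _ _ (fun x => (\det (f x))^-1 *: \adj (f x))).
  by move=> x Ax; rewrite /invmx fu.
apply: smooth_on_scale.
  apply: smooth_on_inv; last exact: smooth_on_det.
  by move=> x /fu; rewrite unitmxE unitfE.
apply/smooth_on_mxP => i j.
apply: (@smooth_on_eq _ _ _ _ (fun x => cofactor (f x) j i : R^o)).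
  by move=> x _; rewrite mxE.
apply: smooth_on_mul; first exact: smooth_on_cst.
apply: smooth_on_det; apply/smooth_on_mxP => k l.
apply: (@smooth_on_eq _ _ _ _ (fun x => f x (lift j k) (lift i l) : R^o)).
  by move=> x _; rewrite !mxE.
exact: (smooth_on_mxP _ _ _).1.
Qed.

(** A directional derivative only sees the values on a line, so that functions
    that agree on a set without interior may be compared along directions in
    which this set is open. *)
Lemma derive_eq_line V W (f g : V -> W) (x v : V) :
  f x = g x -> (\forall h \near (0 : R), f (h *: v + x) = g (h *: v + x)) ->
  'D_v f x = 'D_v g x.
Proof.
move=> fgx fgh; rewrite /derive; congr (lim _).
rewrite eqEsubset; split; apply/near_eq_cvg/cvg_within; near=> h => /=;
  rewrite fgx; (have -> : f (h *: v + x) = g (h *: v + x) by near: h).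
Unshelve. all: by end_near. Qed.

(** [A] may be a product with a compact time interval: it is enough that it is
    open in the direction of the derivative. *)
Lemma smooth_on_derive V W r (A : set V) (f : V -> W) (v : V) :
  (forall x, A x -> \forall h \near (0 : R), A (h *: v + x)) ->
  smooth_on (omap S r) A f -> smooth_on r A ('D_v f).
Proof.
move=> lA [U [g [oU AU Cg fg]]]; exists U, ('D_v g); split=> // [k kr|x Ax].
  have [_ Dg] : Ck k.+1 U g by apply: Cg; case: (r) kr.
  exact: Dg.
apply: derive_eq_line; first exact: fg.
near=> h; apply: fg; near: h; exact: lA.
Unshelve. all: by end_near. Qed.

Lemma smooth_on_differentiable V W X r (A : set W) (j : V -> W) (f : W -> X) y :
  (\forall z \near y, A (j z)) -> differentiable j y ->
  smooth_on (omap S r) A f -> differentiable (f \o j) y.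
Proof.
move=> Aj dj [U [g [oU AU Cg fg]]].
have [dg _] : Ck 1 U g by apply: Cg; case: (r).
apply: (@near_eq_differentiable _ _ _ (g \o j)).
  by near=> z; rewrite /= fg//; near: z.
apply: differentiable_comp => //; apply/dg/AU; exact: nbhs_singleton Aj.
Unshelve. all: by end_near. Qed.

End smooth_on_theory.

(** * Block triangular matrices and right inverses *)

(** A right inverse of a block triangular matrix is built from right inverses of
    its diagonal blocks, whatever the off-diagonal block is. *)
Lemma row_free_lblock (F : fieldType) m1 m2 n1 n2
    (A : 'M[F]_(m1, n1)) (C : 'M[F]_(m2, n1)) (B : 'M[F]_(m2, n2)) :
  row_free A -> row_free B -> row_free (block_mx A 0 C B).
Proof.
move=> /row_freeP[A' AA'] /row_freeP[B' BB'].
apply/row_freeP; exists (block_mx A' 0 (- (B' *m C *m A')) B').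
rewrite mulmx_block !mulmx0 !mul0mx !addr0 AA' mulmxN !mulmxA BB' mul1mx subrr.
by rewrite add0r -scalar_mx_block.
Qed.

(** If [v] annihilates the Gram matrix, the square of the norm of [v *m A] is
    zero: this is where the scalars have to be real. *)
Lemma gram_unit (R : realType) m n (A : 'M[R]_(m, n)) :
  \rank A = m -> A *m A^T \in unitmx.
Proof.
move=> rA; rewrite -row_free_unit -kermx_eq0; apply/rowV0P => v /sub_kermxP vAA.
have vA0 : v *m A = 0.
  have : (v *m A) *m (v *m A)^T = 0.
    by rewrite trmx_mul !mulmxA -(mulmxA v) vAA mul0mx.
  move=> /matrixP/(_ 0 0); rewrite [LHS]mxE [RHS]mxE => /eqP.
  rewrite psumr_eq0 => [/allP s0|k _]; last by rewrite [_^T _ _]mxE -expr2 sqr_ge0.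
  apply/rowP => k; have := s0 k (mem_index_enum _).
  by rewrite [_^T _ _]mxE -expr2 sqrf_eq0 => /eqP ->; rewrite mxE.
have /row_freeP[B AB] : row_free A by rewrite /row_free rA.
by rewrite -[v]mulmx1 -AB mulmxA vA0 mul0mx.
Qed.

(** The Moore-Penrose inverse of a matrix of full row rank: unlike an arbitrary
    right inverse, it depends smoothly on the matrix. *)
Definition right_pinv (R : realType) m n (N : 'M[R]_(m, n)) : 'M[R]_(n, m) :=
  N^T *m invmx (N *m N^T).

Lemma mulmx_right_pinv (R : realType) m n (N : 'M[R]_(m, n)) :
  \rank N = m -> N *m right_pinv N = 1%:M.
Proof. by move=> rN; rewrite mulmxA mulmxV// gram_unit. Qed.

(** * Jacobian matrices *)

Section jac_theory.
Variable R : realType.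

Lemma jacE p q (f : 'rV[R]_p -> 'rV[R]_q) x : differentiable f x ->
  jac f x = \matrix_(i, j) ('D_(delta_mx 0 j) f x) 0 i.
Proof.
by move=> df; apply/matrixP => i j; rewrite !mxE deriveEjacobian// -rowE !mxE.
Qed.

Lemma jac_comp p q s (f : 'rV[R]_p -> 'rV[R]_q) (g : 'rV[R]_q -> 'rV[R]_s) x :
  differentiable f x -> differentiable g (f x) ->
  jac (g \o f) x = jac g (f x) *m jac f x.
Proof.
move=> df dg; rewrite /jac -trmx_mul; congr trmx; apply/row_matrixP => i.
rewrite !rowE mulmxA !mul_rV_lin1 /=.
by rewrite diff_comp.
Qed.

Lemma differentiable_affine p q (M : 'M[R]_(p, q)) (c : 'rV[R]_q) x :
  differentiable (fun y : 'rV[R]_p => y *m M + c) x.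
Proof.
apply: differentiableD => //.
exact: (@linear_differentiable _ _ _ (mulmxr M) _ (linear_continuous_fd _)).
Qed.

Lemma jac_affine p q (M : 'M[R]_(p, q)) (c : 'rV[R]_q) x :
  jac (fun y : 'rV[R]_p => y *m M + c) x = M^T.
Proof.
have cM : continuous (mulmxr M : 'rV[R]_p -> 'rV[R]_q).
  exact: linear_continuous_fd.
rewrite /jac; congr trmx; apply/row_matrixP => i; rewrite !rowE mul_rV_lin1.
rewrite (_ : (fun y => _) = (mulmxr M : _ -> _) + cst c) //.
have dM : differentiable (mulmxr M : 'rV[R]_p -> 'rV[R]_q) x.
  exact: linear_differentiable.
rewrite (diffD dM (differentiable_cst c x)) /=.
have E := congr1 (fun h => h (delta_mx 0 i)) (diff_lin x cM).
have E0 := congr1 (fun h => h (delta_mx 0 i)) (diff_cst c x).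
by apply: etrans (congr2 +%R E E0) _; exact: addr0.
Qed.

Lemma jac_row_mx p q1 q2
    (f : 'rV[R]_p -> 'rV[R]_q1) (g : 'rV[R]_p -> 'rV[R]_q2) x :
  differentiable f x -> differentiable g x ->
  jac (fun y => row_mx (f y) (g y)) x = col_mx (jac f x) (jac g x).
Proof.
move=> df dg.
have dfg : differentiable (fun y => row_mx (f y) (g y)) x.
  rewrite (_ : (fun _ => _) = fun y => f y *m row_mx 1%:M 0 + g y *m row_mx 0 1%:M).
    by apply: differentiableD;
      apply: (differentiable_comp (g := mulmxr _)) => //;
      apply: linear_differentiable; exact: linear_continuous_fd.
  apply/funext => y.
  by rewrite !mul_mx_row !mulmx1 !mulmx0 add_row_mx addr0 add0r.
rewrite (jacE df) (jacE dg) (jacE dfg); apply/matrixP => i j.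
rewrite mxE (derive_mx (diff_derivable dfg)) mxE.
case: (split_ordP i) => k ->.
  rewrite col_mxEu mxE (derive_mx (diff_derivable df)) mxE.
  suff -> : (fun y => row_mx (f y) (g y) 0 (lshift q2 k)) = (fun y => f y 0 k).
    by [].
  by apply/funext => y; rewrite row_mxEl.
rewrite col_mxEd mxE (derive_mx (diff_derivable dg)) mxE.
suff -> : (fun y => row_mx (f y) (g y) 0 (rshift q1 k)) = (fun y => g y 0 k).
  by [].
by apply/funext => y; rewrite row_mxEr.
Qed.

Lemma jac_lsubmx_comp p1 p2 q (f : 'rV[R]_p1 -> 'rV[R]_q) (x : 'rV[R]_(p1 + p2)) :
  differentiable f (lsubmx x) ->
  jac (fun y : 'rV[R]_(p1 + p2) => f (lsubmx y)) x
    = row_mx (jac f (lsubmx x)) 0.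
Proof.
have E : lsubmx = fun y : 'rV[R]_(p1 + p2) => y *m col_mx 1%:M 0 + 0.
  apply/funext => y; rewrite -{2}[y]hsubmxK mul_row_col mulmx1 mulmx0.
  by rewrite !addr0.
rewrite E => df.
rewrite (jac_comp (differentiable_affine _ _ _) df) jac_affine tr_col_mx.
by rewrite trmx1 trmx0 mul_mx_row mulmx1 mulmx0.
Qed.

Lemma jac_rsubmx_comp p1 p2 q (f : 'rV[R]_p2 -> 'rV[R]_q) (x : 'rV[R]_(p1 + p2)) :
  differentiable f (rsubmx x) ->
  jac (fun y : 'rV[R]_(p1 + p2) => f (rsubmx y)) x
    = row_mx 0 (jac f (rsubmx x)).
Proof.
have E : rsubmx = fun y : 'rV[R]_(p1 + p2) => y *m col_mx 0 1%:M + 0.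
  apply/funext => y; rewrite -{2}[y]hsubmxK mul_row_col mulmx1 mulmx0.
  by rewrite addr0 add0r.
rewrite E => df.
rewrite (jac_comp (differentiable_affine _ _ _) df) jac_affine tr_col_mx.
by rewrite trmx1 trmx0 mul_mx_row mulmx1 mulmx0.
Qed.

Lemma rsubmx_jac p1 p2 q (h : 'rV[R]_(p1 + p2) -> 'rV[R]_q) x :
  differentiable h x ->
  rsubmx (jac h x) = jac (fun y => h (row_mx (lsubmx x) y)) (rsubmx x).
Proof.
move=> dh; pose j (y : 'rV[R]_p2) := y *m row_mx 0 1%:M + row_mx (lsubmx x) 0.
have jE y : j y = row_mx (lsubmx x) y.
  by rewrite /j mul_mx_row mulmx0 mulmx1 add_row_mx add0r addr0.
have dj : differentiable j (rsubmx x) := differentiable_affine _ _ _.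
have jx : j (rsubmx x) = x by rewrite jE hsubmxK.
have dh' : differentiable h (j (rsubmx x)) by rewrite jx.
rewrite (_ : (fun y => _) = h \o j); last by apply/funext => y; rewrite /= jE.
rewrite (jac_comp dj dh') jac_affine jx tr_row_mx trmx0 trmx1.
by rewrite -[in RHS](hsubmxK (jac h x)) mul_row_col mulmx0 mulmx1 add0r.
Qed.

End jac_theory.

(** * The rank conditions under one-way coupling *)

(** Conditions (i)-(iii) of Hypothesis H for [mu = 0], where [E] and [A] are the
    Jacobians of the residual with respect to the derivative of the state and to
    the state. *)
Definition pencil_conditions (R : realType) (n a d : nat) (E A : 'M[R]_n)
    (Z : 'M[R]_(n, a)) (T Y : 'M[R]_(n, d)) : Prop :=
  [/\ \rank E = (n - a)%N /\ Z^T *m E = 0,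
      \rank (Z^T *m A) = a /\ Z^T *m A *m T = 0 &
      \rank (E *m T) = d /\ \rank (Y^T *m E *m T) = d].

Lemma pencil_rank_T (R : realType) n a d (E A : 'M[R]_n) (Z : 'M[R]_(n, a))
  (T Y : 'M[R]_(n, d)) : pencil_conditions E A Z T Y -> \rank T = d.
Proof.
move=> [_ _ [rET _]]; apply/eqP; rewrite eqn_leq rank_leq_col /=.
by rewrite -{1}rET mxrankM_maxr.
Qed.

(** The kernel of the algebraic part of the coupled system: a vector [T1 x] in
    the kernel of the first algebraic part is completed by the second component
    that cancels its effect [Z2^T *m C *m T1] on the second one. *)
Definition coupled_kernel (R : realType) n1 n2 a2 d1 d2 (C : 'M[R]_(n2, n1))
    (A2 : 'M[R]_n2) (Z2 : 'M[R]_(n2, a2)) (T1 : 'M[R]_(n1, d1))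
    (T2 : 'M[R]_(n2, d2)) : 'M[R]_(n1 + n2, d1 + d2) :=
  block_mx T1 0 (- (right_pinv (Z2^T *m A2) *m (Z2^T *m C *m T1))) T2.

(** Block triangular coupling: since the derivative of the state enters
    diagonally, the left kernel [Z] of [E] is block diagonal, and [Z^T *m A] is
    block triangular, of full rank because its diagonal blocks are.  The kernel
    [T] is block triangular too, hence so is [Y^T *m E *m T], with invertible
    diagonal blocks that do not depend on the coupling. *)
Lemma pencil_conditions_block (R : realType) n1 n2 a1 a2 d1 d2
    (E1 A1 : 'M[R]_n1) (Z1 : 'M[R]_(n1, a1)) (T1 Y1 : 'M[R]_(n1, d1))
    (E2 A2 : 'M[R]_n2) (Z2 : 'M[R]_(n2, a2)) (T2 Y2 : 'M[R]_(n2, d2))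
    (C : 'M[R]_(n2, n1)) :
  (a1 <= n1)%N -> (a2 <= n2)%N ->
  pencil_conditions E1 A1 Z1 T1 Y1 -> pencil_conditions E2 A2 Z2 T2 Y2 ->
  pencil_conditions (block_mx E1 0 0 E2) (block_mx A1 0 C A2)
    (block_mx Z1 0 0 Z2) (coupled_kernel C A2 Z2 T1 T2) (block_mx Y1 0 0 Y2).
Proof.
move=> an1 an2 [[rE1 ZE1] [rZA1 ZAT1] [rET1 rYET1]].
move=> [[rE2 ZE2] [rZA2 ZAT2] [rET2 rYET2]].
set E := block_mx E1 0 0 E2; set Y := block_mx Y1 0 0 Y2.
set T := coupled_kernel C A2 Z2 T1 T2.
have rYET : \rank (Y^T *m E *m T) = (d1 + d2)%N.
  apply/eqP; rewrite /Y /E /T /coupled_kernel tr_block_mx !trmx0 !mulmx_block.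
  rewrite !(mul0mx, mulmx0, addr0, add0r).
  by apply: row_free_lblock; rewrite /row_free ?rYET1 ?rYET2.
have ZA : (block_mx Z1 0 0 Z2)^T *m block_mx A1 0 C A2
    = block_mx (Z1^T *m A1) 0 (Z2^T *m C) (Z2^T *m A2).
  rewrite tr_block_mx !trmx0 mulmx_block.
  by rewrite !(mul0mx, mulmx0, addr0, add0r).
split; split=> //.
- by rewrite rank_diag_block_mx rE1 rE2 addnBA// addnBAC// subnDA.
- rewrite tr_block_mx !trmx0 mulmx_block ZE1 ZE2.
  by rewrite !(mul0mx, mulmx0, addr0) block_mx0.
- rewrite ZA; apply/eqP; apply: row_free_lblock.
    by rewrite /row_free rZA1.
  by rewrite /row_free rZA2.
- rewrite ZA /T /coupled_kernel mulmx_block.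
  rewrite !(mul0mx, mulmx0, addr0, add0r) ZAT1 ZAT2 mulmxN.
  by rewrite (mulmxA _ (right_pinv _)) mulmx_right_pinv// mul1mx subrr block_mx0.
- apply/eqP; rewrite eqn_leq rank_leq_col /=.
  by rewrite -{1}rYET -mulmxA mxrankM_maxr.
Qed.

Lemma smooth_on_coupled_kernel (R : realType) (V : normedModType R) r
    (A : set V) n1 n2 a2 d1 d2 (C : V -> 'M[R]_(n2, n1)) (A2 : V -> 'M[R]_n2)
    (Z2 : V -> 'M[R]_(n2, a2)) (T1 : V -> 'M[R]_(n1, d1))
    (T2 : V -> 'M[R]_(n2, d2)) :
  (forall x, A x -> \rank ((Z2 x)^T *m A2 x) = a2) ->
  smooth_on r A C -> smooth_on r A A2 -> smooth_on r A Z2 ->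
  smooth_on r A T1 -> smooth_on r A T2 ->
  smooth_on r A (fun x => coupled_kernel (C x) (A2 x) (Z2 x) (T1 x) (T2 x)).
Proof.
move=> rZA sC sA sZ sT1 sT2.
have sZT := smooth_on_tr sZ; have sN := smooth_on_mulmx sZT sA.
have sNT := smooth_on_tr sN.
apply: smooth_on_block => //; first exact: smooth_on_cst.
apply: smooth_on_linear_comp => [k u v|].
  by rewrite opprD scalerN.
apply: smooth_on_mulmx; last by do 2! apply: smooth_on_mulmx => //.
apply: smooth_on_mulmx => //; apply: smooth_on_invmx.
  by move=> x Ax; apply: gram_unit; exact: rZA.
exact: smooth_on_mulmx.
Qed.

(** * Strangeness-free DAEs *)

Section strangeness_free.
Variables (R : realType) (n m : nat).
Implicit Types (I : set R) (D : dae R n m) (r s : option nat).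

(** The jet space for [mu = 0], with the vectors not reshaped by stacking. *)
Definition dae_point : normedModType R :=
  (R^o * 'rV[R]_n * 'rV[R]_n * 'rV[R]_m)%type.

Definition dae_domain I D : set dae_point :=
  [set x | [/\ I x.1.1.1, dom_state D x.1.1.2, dom_deriv D x.1.2
             & dom_input D x.2]].

Definition dae_zeros I D : set dae_point :=
  [set x | dae_domain I D x /\ residual D x.1.1.1 x.1.1.2 x.1.2 x.2 = 0].

Definition jac_state D (x : dae_point) : 'M[R]_n :=
  jac (fun y => residual D x.1.1.1 y x.1.2 x.2) x.1.1.2.

Definition jac_deriv D (x : dae_point) : 'M[R]_n :=
  jac (fun w => residual D x.1.1.1 x.1.1.2 w x.2) x.1.2.

(** Hypothesis H with [mu = 0], where the derivative array is the residual. *)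
Definition strangeness_free r I D (a d : nat) : Prop :=
  [/\ (a <= n)%N, d = (n - a)%N &
  exists (ZA : dae_point -> 'M[R]_(n, a)) (TA ZD : dae_point -> 'M[R]_(n, d)),
  let M := dae_zeros I D in
  [/\ [/\ smooth_on r M ZA, smooth_on r M TA & smooth_on r M ZD],
      forall x, M x -> [/\ \rank (ZA x) = a, \rank (TA x) = d
                         & \rank (ZD x) = d],
      forall u, admissible_input (omap S r) I D u ->
        exists t z w, M (t, z, w, u t) &
      forall x, M x ->
        pencil_conditions (jac_deriv D x) (jac_state D x)
          (ZA x) (TA x) (ZD x)]].

Lemma differentiable_state r I D x : smooth_dae (omap S r) I D ->
  dae_domain I D x ->
  differentiable (fun y => residual D x.1.1.1 y x.1.2 x.2) x.1.1.2.
Proof.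
move=> [os od oi sD] [It st dt ut].
apply: (smooth_on_differentiable (j := fun y => (x.1.1.1 : R^o, y, x.1.2, x.2))
  _ _ sD).
  near=> y; split=> //=; near: y; exact: open_nbhs_nbhs.
by do 3! apply: differentiable_pair => //.
Unshelve. all: by end_near. Qed.

Lemma differentiable_deriv r I D x : smooth_dae (omap S r) I D ->
  dae_domain I D x ->
  differentiable (fun w => residual D x.1.1.1 x.1.1.2 w x.2) x.1.2.
Proof.
move=> [os od oi sD] [It st dt ut].
apply: (smooth_on_differentiable (j := fun w => (x.1.1.1 : R^o, x.1.1.2, w, x.2))
  _ _ sD).
  near=> y; split=> //=; near: y; exact: open_nbhs_nbhs.
by do 3! apply: differentiable_pair => //.
Unshelve. all: by end_near. Qed.

Definition dae_point_of_jet (x : jet_space R n m 0) : dae_point :=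
  (x.1.1.1, x.1.1.2, vec_mx x.1.2, vec_mx x.2).

Definition jet_of_dae_point (x : dae_point) : jet_space R n m 0 :=
  (x.1.1.1, x.1.1.2, mxvec x.1.2, mxvec x.2).

Lemma block0 k (v : 'rV[R]_(1 * k)) : block v 0 = vec_mx v.
Proof.
rewrite /block; case: insubP => [j _ _|//]; rewrite (ord1 j).
by apply/rowP => i; rewrite mxE.
Qed.

Lemma stack1 k (x : nat -> 'rV[R]_k) : stack 1 x = mxvec (x 0%N).
Proof.
by rewrite /stack; congr mxvec; apply/matrixP => i j; rewrite mxE (ord1 i).
Qed.

Lemma derivative_array0 I D t z eta upsilon :
  @derivative_array R n m I D 0 t z eta upsilon
    = mxvec (residual D t z (vec_mx eta) (vec_mx upsilon)).
Proof. by rewrite /derivative_array stack1 /= !block0. Qed.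

Lemma zero_set0 I D x :
  zero_set I D (l := 0) x <-> dae_zeros I D (dae_point_of_jet x).
Proof.
case: x => [[[t z] eta] upsilon]; rewrite /zero_set /= derivative_array0 !block0.
split=> [[It zt dt ut] /(canRL mxvecK)|[[It zt dt ut] e]].
  by rewrite linear0.
by split=> //; rewrite e linear0.
Qed.

Lemma zero_set0_of_point I D x :
  dae_zeros I D x <-> zero_set I D (l := 0) (jet_of_dae_point x).
Proof.
rewrite zero_set0 /dae_point_of_jet /= !mxvecK.
by case: x => [[[t z] w] u].
Qed.

(** Stacking a single vector reshapes ['rV_n] into ['rV_(1 * n)].  As a matrix,
    this isomorphism can be absorbed in [ZA] and in the Jacobians. *)
Definition vec_matrix k : 'M[R]_(k, 1 * k) := lin1_mx (@mxvec R 1 k).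
Definition unvec_matrix k : 'M[R]_(1 * k, k) := lin1_mx (@vec_mx R 1 k).

Lemma mul_vec_matrix k (v : 'rV[R]_k) : v *m vec_matrix k = mxvec v.
Proof. by rewrite mul_rV_lin1. Qed.

Lemma mul_unvec_matrix k (v : 'rV[R]_(1 * k)) : v *m unvec_matrix k = vec_mx v.
Proof. by rewrite mul_rV_lin1. Qed.

Lemma vec_matrixK k : vec_matrix k *m unvec_matrix k = 1%:M.
Proof.
apply/row_matrixP => i.
by rewrite !rowE mulmxA mul_vec_matrix mul_unvec_matrix mxvecK mulmx1.
Qed.

Lemma unvec_matrixK k : unvec_matrix k *m vec_matrix k = 1%:M.
Proof.
apply/row_matrixP => i.
by rewrite !rowE mulmxA mul_unvec_matrix mul_vec_matrix vec_mxK mulmx1.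
Qed.

Lemma jac_array_state r I D (y : jet_space R n m 0) :
  smooth_dae (omap S r) I D -> dae_domain I D (dae_point_of_jet y) ->
  jac (fun z => @derivative_array R n m I D 0 y.1.1.1 z y.1.2 y.2) y.1.1.2
    = (vec_matrix n)^T *m jac_state D (dae_point_of_jet y).
Proof.
move=> sD Dy; have df := differentiable_state sD Dy.
rewrite (_ : (fun z => _) = (fun v => v *m vec_matrix n + 0) \o
    (fun z => residual D y.1.1.1 z (vec_mx y.1.2) (vec_mx y.2))).
  rewrite (jac_comp df (differentiable_affine _ _ _)).
  by rewrite jac_affine.
by apply/funext => z; rewrite derivative_array0 /= addr0 mul_vec_matrix.
Qed.

Lemma jac_array_deriv r I D (y : jet_space R n m 0) :
  smooth_dae (omap S r) I D -> dae_domain I D (dae_point_of_jet y) ->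
  jac (fun e => @derivative_array R n m I D 0 y.1.1.1 y.1.1.2 e y.2) y.1.2
    = (vec_matrix n)^T *m jac_deriv D (dae_point_of_jet y) *m (unvec_matrix n)^T.
Proof.
move=> sD Dy; have df := differentiable_deriv sD Dy.
pose un (v : 'rV[R]_(1 * n)) := v *m unvec_matrix n + 0.
have unE v : un v = vec_mx v by rewrite /un addr0 mul_unvec_matrix.
have dun : differentiable un y.1.2 := differentiable_affine _ _ _.
pose F w := residual D y.1.1.1 y.1.1.2 w (vec_mx y.2).
have dF : differentiable F (un y.1.2) by rewrite unE.
rewrite (_ : (fun z => _) = (fun v => v *m vec_matrix n + 0) \o (F \o un)).
  rewrite (jac_comp (differentiable_comp dun dF) (differentiable_affine _ _ _)).
  by rewrite (jac_comp dun dF) !jac_affine unE mulmxA.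
by apply/funext => e; rewrite derivative_array0 /= addr0 mul_vec_matrix /F unE.
Qed.

(** The Jacobians of the derivative array are those of the residual up to
    invertible reshaping matrices, which do not change ranks; the one on the left
    is absorbed in [ZA]. *)
Lemma rank_conditions0 r I D (a d : nat)
    (ZA : jet_space R n m 0 -> 'M[R]_(1 * n, a))
    (TA ZD : jet_space R n m 0 -> 'M[R]_(n, d)) y :
  smooth_dae (omap S r) I D -> dae_domain I D (dae_point_of_jet y) ->
  rank_conditions I D ZA TA ZD y <->
  pencil_conditions (jac_deriv D (dae_point_of_jet y))
    (jac_state D (dae_point_of_jet y)) (vec_matrix n *m ZA y) (TA y) (ZD y).
Proof.
move=> sD Dy; have := jac_array_deriv sD Dy; have := jac_array_state sD Dy.
case: y Dy => [[[t z] eta] ups] Dy /= Es Ed.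
rewrite /rank_conditions /= {}Es {}Ed !block0.
set x := dae_point_of_jet _; set E := jac_deriv D x; set A := jac_state D x.
have -> : jac (fun w => residual D t z w (vec_mx ups)) (vec_mx eta) = E by [].
set ZAy := ZA _; rewrite /pencil_conditions trmx_mul.
have free_unvecT : row_free (unvec_matrix n)^T.
  apply/row_freeP; exists (vec_matrix n)^T.
  by rewrite -trmx_mul vec_matrixK trmx1.
have -> : \rank ((vec_matrix n)^T *m E *m (unvec_matrix n)^T) = \rank E.
  rewrite mxrankMfree// -mxrank_tr trmx_mul mxrankMfree ?mxrank_tr//.
  rewrite trmxK; apply/row_freeP; exists (unvec_matrix n).
  exact: vec_matrixK.
have kerE : ZAy^T *m ((vec_matrix n)^T *m E *m (unvec_matrix n)^T) = 0 <->
    ZAy^T *m (vec_matrix n)^T *m E = 0.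
  rewrite !mulmxA; split=> [e|->]; last by rewrite mul0mx.
  rewrite -[LHS]mulmx1 -(trmx1 _ n) -(vec_matrixK n) trmx_mul mulmxA.
  by rewrite e mul0mx.
have -> : (1 * n - a)%N = (n - a)%N by rewrite mul1n.
rewrite [ZAy^T *m (_ *m A)]mulmxA.
by split=> -[[? /kerE ?] ? ?]; split.
Qed.

Lemma smooth_dae_point_of_jet r A : smooth_on r A dae_point_of_jet.
Proof.
apply: smooth_on_linear => k [[[? ?] ?] ?] [[[? ?] ?] ?].
by rewrite /dae_point_of_jet /= !linearP.
Qed.

Lemma smooth_jet_of_dae_point r A : smooth_on r A jet_of_dae_point.
Proof.
apply: smooth_on_linear => k [[[? ?] ?] ?] [[[? ?] ?] ?].
by rewrite /jet_of_dae_point /= !linearP.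
Qed.

Lemma jet_of_dae_pointK : cancel jet_of_dae_point dae_point_of_jet.
Proof.
by case=> [[[t z] w] u]; rewrite /dae_point_of_jet /= !mxvecK.
Qed.

Lemma rank_vec_matrix_mul k a (Z : 'M[R]_(1 * k, a)) :
  \rank (vec_matrix k *m Z) = \rank Z.
Proof.
rewrite -mxrank_tr trmx_mul mxrankMfree ?mxrank_tr//.
apply/row_freeP; exists (unvec_matrix k)^T.
by rewrite -trmx_mul unvec_matrixK trmx1.
Qed.

Lemma hypothesis_H0_strangeness_free r I D a d :
  smooth_dae (omap S r) I D -> hypothesis_H r I D 0 a d ->
  strangeness_free r I D a d.
Proof.
move=> sD [an dE [ZA [TA [ZD [[sZA sTA sZD] rk ne cond]]]]].
split=> //.
have MM x := (zero_set0_of_point I D x).1.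
exists (fun x => vec_matrix n *m ZA (jet_of_dae_point x)),
  (TA \o jet_of_dae_point), (ZD \o jet_of_dae_point); split.
- split.
  + apply: smooth_on_mulmx; first exact: smooth_on_cst.
    exact: smooth_on_comp _ _ MM (smooth_jet_of_dae_point r _) sZA.
  + exact: smooth_on_comp _ _ MM (smooth_jet_of_dae_point r _) sTA.
  + exact: smooth_on_comp _ _ MM (smooth_jet_of_dae_point r _) sZD.
- by move=> x /MM /rk [? ? ?]; split=> //; rewrite rank_vec_matrix_mul.
- move=> u /ne [t [z [eta]]]; rewrite stack1 => /zero_set0 /=.
  rewrite /dae_point_of_jet /= mxvecK => M.
  by exists t, z, (vec_mx eta).
- move=> x Mx; have [U Ux cU] := cond _ (MM x Mx).
  have /(rank_conditions0 _ _ _ sD) := cU _ (conj (MM x Mx) (nbhs_singleton Ux)).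
  by rewrite jet_of_dae_pointK; apply; case: Mx.
Qed.

Lemma strangeness_free_hypothesis_H0 r I D a d :
  smooth_dae (omap S r) I D -> strangeness_free r I D a d ->
  hypothesis_H r I D 0 a d.
Proof.
move=> sD [an dE [ZA [TA [ZD [[sZA sTA sZD] rk ne cond]]]]].
split=> //.
have MM x := (zero_set0 I D x).1.
exists (fun y => unvec_matrix n *m ZA (dae_point_of_jet y)),
  (TA \o dae_point_of_jet), (ZD \o dae_point_of_jet).
have ZAK y : vec_matrix n *m (unvec_matrix n *m ZA y) = ZA y.
  by rewrite mulmxA vec_matrixK mul1mx.
split.
- split.
  + apply: smooth_on_mulmx; first exact: smooth_on_cst.
    exact: smooth_on_comp _ _ MM (smooth_dae_point_of_jet r _) sZA.
  + exact: smooth_on_comp _ _ MM (smooth_dae_point_of_jet r _) sTA.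
  + exact: smooth_on_comp _ _ MM (smooth_dae_point_of_jet r _) sZD.
- by move=> y /MM /rk [? ? ?]; split=> //; rewrite -rank_vec_matrix_mul ZAK.
- move=> u /ne [t [z [w Mw]]]; exists t, z, (mxvec w).
  by apply/zero_set0; rewrite stack1 /dae_point_of_jet /= !mxvecK.
- move=> x _; exists setT; first exact: filterT.
  move=> y [/MM My _]; apply/(rank_conditions0 _ _ _ sD); first by case: My.
  by rewrite /= ZAK; exact: cond.
Qed.

End strangeness_free.

(** The entries are directional derivatives of the residual, along directions in
    which the domain is open even if the time interval is compact. *)
Lemma smooth_on_jac_state (R : realType) n m r (I : set R) (D : dae R n m) :
  smooth_dae (omap S r) I D -> smooth_on r (dae_domain I D) (jac_state D).
Proof.
move=> sD; have [os od oi sF] := sD.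
pose F (p : dae_point R n m) := residual D p.1.1.1 p.1.1.2 p.1.2 p.2.
apply/smooth_on_mxP => i j.
pose v : dae_point R n m := (0, delta_mx 0 j, 0, 0).
apply: (@smooth_on_eq _ _ _ _ _ (fun x => ('D_v F x) 0 i : R^o)).
  move=> x Dx; rewrite /jac_state (jacE (differentiable_state sD Dx)) mxE.
  suff -> : 'D_v F x = 'D_(delta_mx 0 j)
      (fun y => residual D x.1.1.1 y x.1.2 x.2) x.1.1.2 by [].
  apply: (congr1 (fun k : R -> 'rV[R]_n => lim (k @ 0^'))); apply/funext => h /=.
  by rewrite /F /= !scaler0 !add0r; case: x {Dx} => [[[? ?] ?] ?].
apply: (smooth_on_mxP _ _ _).1.
apply: smooth_on_derive sF => -[[[t z] w] u] /= [It zt wt ut].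
have zc : (h *: delta_mx 0 j + z) @[h --> (0 : R)] --> z.
  rewrite -[X in _ --> X]add0r -(scale0r (delta_mx 0 j)).
  by apply: cvgD; [exact: cvgZr_tmp|exact: cvg_cst].
have : \forall h \near (0 : R), dom_state D (h *: delta_mx 0 j + z).
  by apply: zc; exact: open_nbhs_nbhs.
apply: filterS => h hz.
by split; rewrite /= ?scaler0 ?add0r.
Qed.

(** * The shifted hybrid model *)

Section hybrid.
Variables (R : realType) (n1 n2 m1 m2 : nat) (t0 tf tau : R) (r : option nat).
Variables (D1 : dae R n1 m1) (G1 : R -> 'rV[R]_n1 -> 'rV[R]_m2).
Variables (D2 : dae R n2 m2) (G2 : R -> 'rV[R]_n2 -> 'rV[R]_m1).
Let I := `[t0, tf]%classic.
Hypothesis D1_smooth : smooth_dae (omap S r) I D1.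
Hypothesis D2_smooth : smooth_dae (omap S r) I D2.
Hypothesis G1_smooth : smooth_on (omap S r)
  [set p : R^o * 'rV[R]_n1 | I p.1 /\ dom_state D1 p.2]
  (fun p : R^o * 'rV[R]_n1 => G1 p.1 p.2).
Hypothesis G2_smooth : smooth_on (omap S r)
  [set p : R^o * 'rV[R]_n2 | `[t0 - tau, tf]%classic p.1 /\ dom_state D2 p.2]
  (fun p : R^o * 'rV[R]_n2 => G2 p.1 p.2).
Hypothesis G1_input : forall t z, I t -> dom_state D1 z -> dom_input D2 (G1 t z).
Hypothesis G2_input : forall t z, I t -> dom_state D2 z ->
  dom_input D1 (G2 (t - tau) z).
Hypothesis tau_gt0 : 0 < tau.

Let D := associated_dae (shifted_hybrid tau D1 G1 D2 G2).
Let point := dae_point R (n1 + n2) (n1 + n2).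

(** The point of the first subsystem seen from a point of the hybrid model: its
    input is the delayed output of the second subsystem. *)
Definition first_point (x : point) : dae_point R n1 m1 :=
  (x.1.1.1, lsubmx x.1.1.2, lsubmx x.1.2, G2 (x.1.1.1 - tau) (rsubmx x.2)).

Definition second_point (x : point) : dae_point R n2 m2 :=
  (x.1.1.1, rsubmx x.1.1.2, rsubmx x.1.2, G1 x.1.1.1 (lsubmx x.1.1.2)).

Lemma first_point_domain x :
  dae_domain I D x -> dae_domain I D1 (first_point x).
Proof.
by move=> [It [zt1 zt2] [wt1 wt2] [ut1 ut2]]; split=> //; exact: G2_input.
Qed.

Lemma second_point_domain x :
  dae_domain I D x -> dae_domain I D2 (second_point x).
Proof.
by move=> [It [zt1 zt2] [wt1 wt2] [ut1 ut2]]; split=> //; exact: G1_input.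
Qed.

Lemma hybrid_zeros x : dae_zeros I D x ->
  dae_zeros I D1 (first_point x) /\ dae_zeros I D2 (second_point x).
Proof.
move=> [Dx /eqP]; rewrite /D /= row_mx_eq0 => /andP[/eqP e1 /eqP e2].
by split; split=> //; [exact: first_point_domain|exact: second_point_domain].
Qed.

Lemma delayed_time t : I t -> `[t0 - tau, tf]%classic (t - tau).
Proof.
rewrite /I /= !in_itv /= => /andP[t0t ttf].
by rewrite lerD2r t0t /= lerBlDr (le_trans ttf)// lerDl ltW.
Qed.

Lemma smooth_delayed_output (V : normedModType R) (A : set V)
    (t : V -> R^o) (z : V -> 'rV[R]_n2) :
  (forall x, A x -> I (t x) /\ dom_state D2 (z x)) ->
  smooth_on (omap S r) A t -> smooth_on (omap S r) A z ->
  smooth_on (omap S r) A (fun x => G2 (t x - tau) (z x)).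
Proof.
move=> AD st sz.
apply: (smooth_on_comp (g := fun x => ((t x - tau : R^o), z x)) _ _ _ _ G2_smooth).
  by move=> x /AD [It zt]; split=> //; exact: delayed_time.
by apply: smooth_on_pair => //; apply: smooth_on_add => //; exact: smooth_on_cst.
Qed.

Lemma smooth_output (V : normedModType R) (A : set V)
    (t : V -> R^o) (z : V -> 'rV[R]_n1) :
  (forall x, A x -> I (t x) /\ dom_state D1 (z x)) ->
  smooth_on (omap S r) A t -> smooth_on (omap S r) A z ->
  smooth_on (omap S r) A (fun x => G1 (t x) (z x)).
Proof.
move=> AD st sz.
apply: (smooth_on_comp (g := fun x => (t x, z x)) _ _ _ _ G1_smooth) => //.
exact: smooth_on_pair.
Qed.

Lemma smooth_first_point : smooth_on (omap S r) (dae_domain I D) first_point.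
Proof.
apply: smooth_on_pair; last first.
  apply: smooth_delayed_output.
  - by move=> x [? [? ?] ? [? ?]].
  - exact: smooth_on_fst3.
  - by apply: smooth_on_linear => k x y; rewrite /= linearP.
by apply: smooth_on_linear => k x y; rewrite /= !linearP.
Qed.

Lemma smooth_second_point : smooth_on (omap S r) (dae_domain I D) second_point.
Proof.
apply: smooth_on_pair; last first.
  apply: smooth_output.
  - by move=> x [? [? ?] ? [? ?]].
  - exact: smooth_on_fst3.
  - by apply: smooth_on_linear => k x y; rewrite /= linearP.
by apply: smooth_on_linear => k x y; rewrite /= !linearP.
Qed.

Lemma hybrid_smooth : smooth_dae (omap S r) I D.
Proof.
have [os1 od1 _ sF1] := D1_smooth; have [os2 od2 _ sF2] := D2_smooth.
have osplit (A1 : set 'rV[R]_n1) (A2 : set 'rV[R]_n2) : open A1 -> open A2 ->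
    open [set z : 'rV[R]_(n1 + n2) | A1 (lsubmx z) /\ A2 (rsubmx z)].
  move=> oA1 oA2; apply: openI; apply: open_comp => // z _.
    exact: continuous_lsubmx.
  exact: continuous_rsubmx.
split; [exact: osplit..|].
apply: smooth_on_row_mx.
  exact: smooth_on_comp _ _ first_point_domain smooth_first_point sF1.
exact: smooth_on_comp _ _ second_point_domain smooth_second_point sF2.
Qed.

Lemma jac_deriv_hybrid x : dae_domain I D x ->
  jac_deriv D x = block_mx (jac_deriv D1 (first_point x)) 0
                           0 (jac_deriv D2 (second_point x)).
Proof.
move=> Dx.
have df1 := differentiable_deriv D1_smooth (first_point_domain Dx).
have df2 := differentiable_deriv D2_smooth (second_point_domain Dx).
rewrite {1}/jac_deriv.
have dl := differentiable_comp (differentiable_lsubmx _) df1.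
have dr := differentiable_comp (differentiable_rsubmx _) df2.
rewrite (jac_row_mx dl dr) (jac_lsubmx_comp df1) (jac_rsubmx_comp df2).
by [].
Qed.

(** The first row has a zero block because the first subsystem only sees the
    delayed state of the second one, which is an independent variable here: this
    is the effect of the shift.  The conditions hold for any coupling block in the
    second row, so this block is left unexpanded. *)
Lemma jac_state_hybrid x : dae_domain I D x ->
  jac_state D x = block_mx (jac_state D1 (first_point x)) 0
    (dlsubmx (jac_state D x)) (jac_state D2 (second_point x)).
Proof.
move=> Dx.
have df1 := differentiable_state D1_smooth (first_point_domain Dx).
have dl := differentiable_comp (differentiable_lsubmx _) df1.
have dh := differentiable_comp (differentiable_state hybrid_smooth Dx)
  (differentiable_rsubmx _).
pose h y := residual D2 x.1.1.1 (rsubmx y) (rsubmx x.1.2) (G1 x.1.1.1 (lsubmx y)).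
have {}dh : differentiable h x.1.1.2.
  rewrite (_ : h = rsubmx \o (fun y => residual D x.1.1.1 y x.1.2 x.2))//.
  by apply/funext => y; rewrite /= row_mxKr.
have E : jac_state D x = col_mx (row_mx (jac_state D1 (first_point x)) 0)
                                (jac h x.1.1.2).
  rewrite {1}/jac_state (jac_row_mx dl dh) (jac_lsubmx_comp df1).
  by [].
rewrite {1}E block_mxEv; congr col_mx.
rewrite /dlsubmx E col_mxKd -[LHS]hsubmxK; congr row_mx.
rewrite (rsubmx_jac dh); congr (jac _ _); apply/funext => y.
by rewrite /h row_mxKl row_mxKr.
Qed.

(** The state of the first subsystem is kept constant in the input of the second
    one, because a solution of the first subsystem need not be smooth enough to
    give an admissible input. *)
Lemma hybrid_zeros_nonempty a1 d1 u :
  strangeness_free r I D1 a1 d1 -> regular_dae (omap S r) t0 tf D2 ->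
  admissible_input (omap S r) I D u ->
  exists t z w, dae_zeros I D (t, z, w, u t).
Proof.
move=> [_ _ [_ [_ [_ [_ _ ne1 _]]]]] reg2 [su Du].
have sid : smooth_on (omap S r) (I : set R^o) (fun t : R^o => t).
  exact: smooth_on_linear.
have [t [z1 [w1 [[It zt1 wt1 ut1] /= e1]]]] :
    exists t z w, dae_zeros I D1 (t, z, w, G2 (t - tau) (rsubmx (u t))).
  apply: (ne1 (fun t => G2 (t - tau) (rsubmx (u t)))); split.
    apply: (smooth_delayed_output (t := fun t => t)) => //.
      by move=> t It; split=> //; have [] := Du t It.
    by apply: smooth_on_linear_comp su => k x y; rewrite linearP.
  by move=> t It; apply: G2_input => //; have [] := Du t It.
have adm2 : admissible_input (omap S r) I D2 (fun s => G1 s z1).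
  split; last by move=> s Is; exact: G1_input.
  by apply: (smooth_output (t := fun t => t) (z := fun=> z1)) => //;
    exact: smooth_on_cst.
have [[z2 [_ z2s]] _] := reg2 _ adm2.
have [zt2 wt2 e2] := z2s t It.
exists t, (row_mx z1 (z2 t)), (row_mx w1 (derive_in I z2 t)).
split; last by rewrite /= !row_mxKl !row_mxKr e1 e2 row_mx0.
by split; rewrite /= ?row_mxKl ?row_mxKr//; exact: Du.
Qed.

Lemma hybrid_strangeness_free a1 d1 a2 d2 :
  strangeness_free r I D1 a1 d1 -> strangeness_free r I D2 a2 d2 ->
  regular_dae (omap S r) t0 tf D2 ->
  strangeness_free r I D (a1 + a2) (d1 + d2).
Proof.
move=> SF1 SF2 reg2.
have [an1 dE1 [Z1 [T1 [Y1 [[sZ1 sT1 sY1] rk1 _ cond1]]]]] := SF1.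
have [an2 dE2 [Z2 [T2 [Y2 [[sZ2 sT2 sY2] rk2 _ cond2]]]]] := SF2.
split; [exact: leq_add|by rewrite dE1 dE2 addnBA// addnBAC// subnDA|].
pose M := dae_zeros I D; pose p1 := first_point; pose p2 := second_point.
have M1 x : M x -> dae_zeros I D1 (p1 x) by move=> /hybrid_zeros [].
have M2 x : M x -> dae_zeros I D2 (p2 x) by move=> /hybrid_zeros [].
have MD : M `<=` dae_domain I D by move=> x [].
have sp1 : smooth_on r M p1.
  exact/(smooth_on_subset MD)/smooth_on_pred/smooth_first_point.
have sp2 : smooth_on r M p2.
  exact/(smooth_on_subset MD)/smooth_on_pred/smooth_second_point.
have s0 p q : smooth_on r M (fun=> 0 : 'M[R]_(p, q)) by exact: smooth_on_cst.
pose TA x := coupled_kernel (dlsubmx (jac_state D x)) (jac_state D2 (p2 x))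
  (Z2 (p2 x)) (T1 (p1 x)) (T2 (p2 x)).
exists (fun x => block_mx (Z1 (p1 x)) 0 0 (Z2 (p2 x))), TA,
  (fun x => block_mx (Y1 (p1 x)) 0 0 (Y2 (p2 x))).
have cond x : M x -> pencil_conditions (jac_deriv D x) (jac_state D x)
    (block_mx (Z1 (p1 x)) 0 0 (Z2 (p2 x))) (TA x)
    (block_mx (Y1 (p1 x)) 0 0 (Y2 (p2 x))).
  move=> Mx; rewrite (jac_deriv_hybrid (MD _ Mx)) (jac_state_hybrid (MD _ Mx)).
  exact: pencil_conditions_block an1 an2 (cond1 _ (M1 _ Mx)) (cond2 _ (M2 _ Mx)).
split=> //.
- split.
  + by apply: smooth_on_block => //;
      [exact: smooth_on_comp M1 sp1 sZ1|exact: smooth_on_comp M2 sp2 sZ2].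
  + apply: smooth_on_coupled_kernel.
    * by move=> x /M2 /cond2 [_ [-> _] _].
    * apply: smooth_on_linear_comp
        (smooth_on_subset MD (smooth_on_jac_state hybrid_smooth)).
      by move=> k A B; rewrite /dlsubmx !linearP.
    * apply: smooth_on_comp M2 sp2 _.
      apply: smooth_on_subset (smooth_on_jac_state D2_smooth).
      by move=> x [].
    * exact: smooth_on_comp M2 sp2 sZ2.
    * exact: smooth_on_comp M1 sp1 sT1.
    * exact: smooth_on_comp M2 sp2 sT2.
  + by apply: smooth_on_block => //;
      [exact: smooth_on_comp M1 sp1 sY1|exact: smooth_on_comp M2 sp2 sY2].
- move=> x Mx; have [rZ1 _ rY1] := rk1 _ (M1 _ Mx).
  have [rZ2 _ rY2] := rk2 _ (M2 _ Mx).
  split; last 1 first.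
  + by rewrite rank_diag_block_mx rY1 rY2.
  + by rewrite rank_diag_block_mx rZ1 rZ2.
  + exact: pencil_rank_T (cond x Mx).
- by move=> u; exact: hybrid_zeros_nonempty SF1 reg2.
Qed.

End hybrid.

Theorem theorem4p10 (R : realType) (n1 n2 m1 m2 : nat) (t0 tf tau : R)
    (r : option nat)
    (D1 : dae R n1 m1) (G1 : R -> 'rV[R]_n1 -> 'rV[R]_m2)
    (D2 : dae R n2 m2) (G2 : R -> 'rV[R]_n2 -> 'rV[R]_m1)
    (a1 d1 a2 d2 : nat)
    (I := `[t0, tf]%classic)
    (t0_lt_tf : t0 < tf)
    (D1_smooth : smooth_dae (omap S r) I D1)
    (D2_smooth : smooth_dae (omap S r) I D2)
    (G1_smooth : smooth_on (omap S r)
       [set p : R^o * 'rV[R]_n1 | I p.1 /\ dom_state D1 p.2]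
       (fun p : R^o * 'rV[R]_n1 => G1 p.1 p.2))
    (G2_smooth : smooth_on (omap S r)
       [set p : R^o * 'rV[R]_n2 | `[t0 - tau, tf]%classic p.1 /\ dom_state D2 p.2]
       (fun p : R^o * 'rV[R]_n2 => G2 p.1 p.2))
    (G1_input : forall t z, I t -> dom_state D1 z -> dom_input D2 (G1 t z))
    (G2_input : forall t z, I t -> dom_state D2 z ->
       dom_input D1 (G2 (t - tau) z))
    (D1_regular : regular_dae (omap S r) t0 tf D1)
    (D2_regular : regular_dae (omap S r) t0 tf D2)
    (H1 : hypothesis_H r I D1 0 a1 d1)
    (H2 : hypothesis_H r I D2 0 a2 d2)
    (tau_gt0 : 0 < tau) :
  delay_hypothesis_H r I (shifted_hybrid tau D1 G1 D2 G2)
    0 (a1 + a2) (d1 + d2).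
Proof.
apply: strangeness_free_hypothesis_H0; first exact: hybrid_smooth.
apply: hybrid_strangeness_free => //.
  exact: hypothesis_H0_strangeness_free H1.
exact: hypothesis_H0_strangeness_free H2.
Qed.
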